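(* For every integer $n\ge 0$, the independence polynomial $I(G_n;x)$ of the graph $G_n$ (the ladder with $n$ rungs with one pendant vertex attached at an end corner, as defined in the context) is symmetric and has only real zeros.
   Context: All graphs are finite and simple. An independent set of a graph $G$ is a set of pairwise non-adjacent vertices; $\alpha(G)$ is the size of a largest independent set. The independence polynomial is $I(G;x)=\sum_{k=0}^{\alpha(G)}i_k(G)x^k$, where $i_k(G)$ is the number of independent sets of cardinality $k$ in $G$ and $i_0(G)=1$. A polynomial $\sum_{k=0}^d c_kx^k$ of degree $d$ with nonnegative coefficients is symmetric if $c_k=c_{d-k}$ for $0\le k\le\lfloor d/2\rfloor$. Definition of $G_n$: for $n\ge1$ let $H_n$ be the ladder graph with vertices $s_1,\ldots,s_n,t_1,\ldots,t_n$ and edges $s_it_i$ for $1\le i\le n$, and $s_is_{i+1}$, $t_it_{i+1}$ for $1\le i\le n-1$. Then $G_n$ is obtained from $H_n$ by adding one new vertex $u$ and the single edge $us_n$. Thus $H_1=K_2$ and $G_1=K_{1,2}$. For $n=0$, $H_0=\emptyset$ and $G_0=K_1$ (the single vertex $u$). *)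

(* Defs.v *)
From mathcomp Require Import all_boot all_order all_algebra.
From mathcomp Require Import complex reals.
Set Implicit Arguments.
Unset Strict Implicit.
Unset Printing Implicit Defensive.
Import Order.TTheory GRing.Theory Num.Theory.
Local Open Scope ring_scope.

(* A finite simple graph is a symmetric irreflexive relation on a finType. *)

Definition independent (T : finType) (e : rel T) (S : {set T}) : bool :=
  [forall x in S, forall y in S, ~~ e x y].

Definition alpha (T : finType) (e : rel T) : nat :=
  \max_(S : {set T} | independent e S) #|S|.

Definition indep_count (T : finType) (e : rel T) (k : nat) : nat :=
  #|[set S : {set T} | independent e S & #|S| == k]|.

Definition indep_poly (T : finType) (e : rel T) : {poly int} :=
  \poly_(k < (alpha e).+1) (indep_count e k)%:Z.

(* The degree of p is (size p).-1. *)
Definition symmetric_poly (p : {poly int}) : Prop :=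
  let d := (size p).-1 in
  (forall k : nat, 0 <= p`_k) /\
  (forall k : nat, (k <= d./2)%N -> p`_k = p`_(d - k)).

Definition only_real_zeros (R : realType) (p : {poly int}) : Prop :=
  forall z : R[i], root (map_poly intr p) z -> z \is Num.real.

(* Vertex (false, i) is s_{i+1} and vertex (true, i) is t_{i+1}. *)
Definition ladder (n : nat) : rel (bool * 'I_n) := fun x y =>
  ((x.2 == y.2) && (x.1 != y.1)) ||
  ((x.1 == y.1) && ((x.2.+1 == y.2 :> nat) || (y.2.+1 == x.2 :> nat))).

(* The new vertex u is None; its only neighbour is s_n. *)
Definition pendant_ladder (n : nat) : rel (option (bool * 'I_n)) := fun x y =>
  match x, y with
  | Some v, Some w => @ladder n v w
  | None, Some v | Some v, None => (v.1 == false) && (v.2.+1 == n :> nat)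
  | None, None => false
  end.
Arguments pendant_ladder : clear implicits.

Lemma ladder_sym (n : nat) : symmetric (@ladder n).
Proof.
move=> x y; rewrite /ladder (eq_sym x.2 y.2) (eq_sym x.1 y.1).
by rewrite (orbC (x.2.+1 == y.2 :> nat)).
Qed.

Lemma ladder_irr (n : nat) : irreflexive (@ladder n).
Proof. by move=> x; rewrite /ladder !eqxx /= orbb gtn_eqF. Qed.

Lemma pendant_ladder_sym (n : nat) : symmetric (pendant_ladder n).
Proof. by case=> [v|] [w|] //=; apply: ladder_sym. Qed.

Lemma pendant_ladder_irr (n : nat) : irreflexive (pendant_ladder n).
Proof. by case=> [v|] //=; apply: ladder_irr. Qed.

(* Main.v *)
Require Import Defs.
From mathcomp Require Import all_boot all_order all_algebra.
From mathcomp Require Import complex reals.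
From mathcomp Require Import ring zify.

(** The independence polynomial of [G_n] is [f_(n+1)], where
    [f_0 = 1], [f_1 = 1 + x] and [f_(m+2) = (1 + x) f_(m+1) + x f_m].
    Both claims are read off this recurrence.

    The recurrence comes from deleting one vertex [v] at a time:
    [I(A) = I(A - v) + x I(A - N[v])] ([indep_poly_in_delete]).  The sets met
    on the way are the first [k] rungs, possibly without one of the two
    corners of the last of these rungs.  All of them live inside one fixed
    graph [G_n], so that no isomorphisms between ladders of different lengths
    are needed; the polynomial of the first [k] rungs minus a corner turns out
    to be [f_k], whichever corner it is ([indep_poly_in_rungs]).

    Symmetry: the coefficient [D(i, j)] of [x^i] in [f_(i+j)] satisfies
    [D(i+1, j+1) = D(i, j+1) + D(i+1, j) + D(i, j)] with boundary values 1,
    which is symmetric in [i] and [j]; these are the Delannoy numbers.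

    Real zeros: let [Im z > 0].  The ratios [r_m = f_(m+1)(z) / f_m(z)] satisfy
    [r_(m+1) = 1 + z + z / r_m].  The open sector of arguments between [0] and
    [arg z] is a convex cone since [arg z < pi], it contains [1 + z], and it is
    stable under [r |-> z / r]; hence it contains every [r_m], and no [f_m]
    vanishes at [z] ([delannoy_sector]).  Conjugation deals with [Im z < 0]. *)

Set Implicit Arguments.
Unset Strict Implicit.
Unset Printing Implicit Defensive.
Import Order.TTheory GRing.Theory Num.Theory.
Local Open Scope ring_scope.

(** * Independence polynomials of induced subgraphs *)

Section IndepPolyIn.
Variables (T : finType) (e : rel T).

Definition indep_poly_in (A : {set T}) : {poly int} :=
  \sum_(S : {set T} | (S \subset A) && independent e S) 'X^#|S|.

Lemma independentP (S : {set T}) :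
  reflect {in S &, forall x y, ~~ e x y} (independent e S).
Proof.
apply: (iffP forall_inP) => [H x y xS yS|H x xS].
  exact: (forall_inP (H x xS)).
by apply/forall_inP => y; apply: H.
Qed.

Lemma indep_poly_in_setT : indep_poly_in setT = indep_poly e.
Proof.
apply/polyP => k; rewrite coef_poly /indep_poly_in coef_sum.
rewrite (eq_bigl (independent e)) => [|S]; last by rewrite subsetT.
have -> : \sum_(S | independent e S) ('X^#|S| : {poly int})`_k
    = (indep_count e k)%:Z.
  rewrite /indep_count -sum1_card -natz natr_sum.
  rewrite [RHS](eq_bigl (fun S : {set T} => independent e S && (#|S| == k)));
    last by move=> S; rewrite inE.
  rewrite big_mkcondr; apply: eq_bigr => S _.
  by rewrite coefXn eq_sym; case: eqP.
(* Above the independence number the count is zero, so truncating there is harmless. *)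
case: ltnP => // lt_alpha_k; congr Posz.
apply/eqP; rewrite cards_eq0; apply/eqP/setP => S; rewrite !inE.
apply/negP => /andP[indS /eqP cardS].
have := @leq_bigmax_cond _ (independent e) (fun S : {set T} => #|S|) S indS.
by rewrite cardS leqNgt [X in ~~ X]lt_alpha_k.
Qed.

Lemma indep_poly_in_set0 : indep_poly_in set0 = 1.
Proof.
rewrite /indep_poly_in (big_pred1 set0) ?cards0 // => S /=.
rewrite subset0; case: eqP => //= ->.
by apply/independentP => x y; rewrite inE.
Qed.

Hypotheses (e_sym : symmetric e) (e_irr : irreflexive e).

Lemma independentU1 (v : T) (S : {set T}) :
  independent e (v |: S) = independent e S && [forall y in S, ~~ e v y].
Proof.
apply/independentP/andP => [H|[/independentP indS /forall_inP vS] x y].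
  split; first by apply/independentP => x y xS yS; apply: H; rewrite !inE ?xS ?yS orbT.
  by apply/forall_inP => y yS; apply: H; rewrite !inE ?eqxx ?yS ?orbT.
rewrite !inE => /predU1P[->|xS] /predU1P[->|yS].
- by rewrite e_irr.
- exact: vS.
- by rewrite e_sym vS.
- exact: indS.
Qed.

(** An independent set either avoids [v], or is [v] together with an
    independent set that avoids the closed neighbourhood of [v]. *)
Lemma indep_poly_in_delete (A : {set T}) (v : T) : v \in A ->
  indep_poly_in A =
    indep_poly_in (A :\ v)
    + 'X * indep_poly_in [set w in A | (w != v) && ~~ e v w].
Proof.
move=> vA; rewrite /indep_poly_in (bigID (fun S : {set T} => v \in S)) /= addrC.
congr (_ + _).
  by apply: eq_bigl => S; rewrite subsetD1 -!andbA; congr (_ && _); rewrite andbC.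
rewrite (reindex_onto (fun S => v |: S) (fun S => S :\ v)) => [|S /andP[_ vS]];
  last by rewrite setD1K.
rewrite big_distrr /=; apply: eq_big => [S|S].
  rewrite setU11 andbT independentU1 subUset sub1set vA /=.
  have [vS|vS] := boolP (v \in S).
    rewrite [_ == S]negbTE ?andbF; last first.
      by apply/eqP => /setP/(_ v); rewrite vS !inE eqxx.
    by apply/esym/negbTE/negP => /andP[/subsetP/(_ v vS)]; rewrite !inE eqxx andbF.
  rewrite setU1K // eqxx andbT.
  apply/andP/andP => [[SA /andP[indS /forall_inP vN]]|[SA indS]].
    split=> //; apply/subsetP => w wS; rewrite inE (subsetP SA) // vN // andbT.
    by apply: contraNneq vS => <-.
  rewrite indS; split.
    by apply: subset_trans SA _; apply/subsetP => w; rewrite inE => /andP[].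
  by apply/forall_inP => w /(subsetP SA); rewrite inE => /and3P[].
case/andP => _ /eqP eqS; rewrite cardsU1.
have -> : v \notin S by rewrite -eqS !inE eqxx.
by rewrite exprS.
Qed.

End IndepPolyIn.

(** * The Delannoy recurrence *)

Fixpoint delannoy_poly (m : nat) : {poly int} :=
  match m with
  | 0 => 1
  | m1.+1 => match m1 with
             | 0 => 1 + 'X
             | m2.+1 => (1 + 'X) * delannoy_poly m1 + 'X * delannoy_poly m2
             end
  end.

Lemma delannoy_polySS (m : nat) :
  delannoy_poly m.+2 = (1 + 'X) * delannoy_poly m.+1 + 'X * delannoy_poly m.
Proof. by []. Qed.

Lemma coef_delannoySS (m k : nat) :
  (delannoy_poly m.+2)`_k.+1 =
  (delannoy_poly m.+1)`_k.+1 + (delannoy_poly m.+1)`_k + (delannoy_poly m)`_k.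
Proof. by rewrite delannoy_polySS mulrDl mul1r !coefD !coefXM. Qed.

Lemma coef0_delannoy (m : nat) : (delannoy_poly m)`_0 = 1.
Proof.
elim: m => [|[|m] IH]; [by rewrite coefC | by rewrite coefD coefC coefX |].
by rewrite delannoy_polySS mulrDl mul1r !coefD !coefXM !addr0 IH.
Qed.

Lemma coef_delannoy_gt (m k : nat) : (m < k)%N -> (delannoy_poly m)`_k = 0.
Proof.
elim/ltn_ind: m k => -[|[|m]] IH [|k] // mk.
- by rewrite coefC.
- by case: k mk => // k _; rewrite coefD coefC coefX.
- by rewrite coef_delannoySS !IH ?addr0 // ltnW.
Qed.

Lemma coef_delannoy_diag (m : nat) : (delannoy_poly m)`_m = 1.
Proof.
elim/ltn_ind: m => -[|[|m]] IH; [by rewrite coefC | by rewrite coefD coefC coefX |].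
by rewrite coef_delannoySS IH // !coef_delannoy_gt // add0r addr0.
Qed.

Lemma size_delannoy (m : nat) : size (delannoy_poly m) = m.+1.
Proof.
apply/eqP; rewrite eqn_leq; apply/andP; split.
  by apply/leq_sizeP => k; apply: coef_delannoy_gt.
rewrite ltnNge; apply/negP => /leq_sizeP/(_ m (leqnn m)) /eqP.
by rewrite coef_delannoy_diag.
Qed.

(** Under [i <-> j] the three-term relation
    [D(i+1, j+1) = D(i+1, j) + D(i, j+1) + D(i, j)] only swaps two terms. *)
Lemma coef_delannoy_sym (i j : nat) :
  (delannoy_poly (i + j))`_i = (delannoy_poly (i + j))`_j.
Proof.
have [m] := ubnP (i + j); elim: m i j => // m IH [|i] [|j] // le_m.
- by rewrite coef0_delannoy coef_delannoy_diag.
- by rewrite addn0 coef0_delannoy coef_delannoy_diag.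
rewrite addSn addnS !coef_delannoySS; congr (_ + _); last by apply: IH; lia.
rewrite addrC -{1}addnS -addSn; congr (_ + _); last by apply: IH; lia.
by rewrite addSnnS; apply: IH; lia.
Qed.

(** * Real-rootedness *)

Section RealZeros.
Variable C : numClosedFieldType.
Implicit Types (z : C) (m : nat).

Local Notation f m z := (map_poly intr (delannoy_poly m)).[z].

Lemma horner_delannoySS m z : f m.+2 z = (1 + z) * f m.+1 z + z * f m z.
Proof.
by rewrite delannoy_polySS !(rmorphD, rmorphM, rmorph1) /= map_polyX !hornerE.
Qed.

(** Division-free form of: the ratio [r = f_(m+1)(z) / f_m(z)] and [z / r]
    both have positive imaginary part, that is, [0 < arg r < arg z]. *)
Lemma delannoy_sector m z : 0 < 'Im z ->
  0 < 'Im (f m.+1 z * (f m z)^*) /\ 0 < 'Im (z * f m z * (f m.+1 z)^*).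
Proof.
move=> z_gt0; elim: m => [|m [IH1 IH2]].
  rewrite /= rmorph1 rmorphD rmorph1 /= map_polyX !hornerE.
  rewrite rmorphD rmorph1 mulrDr mulr1 -normCK !raddfD /=.
  have -> : 'Im (1 : C) = 0 by apply/Creal_ImP; rewrite rpred1.
  have -> : 'Im (`|z| ^+ 2) = 0 by apply/Creal_ImP; rewrite rpredX ?normr_real.
  by rewrite add0r addr0 rmorph1 mulr1.
rewrite horner_delannoySS; set p := f m z in IH1 IH2 *.
set q := f m.+1 z in IH1 IH2 *.
have realM a b : 'Im (`|a| ^+ 2 * b) = `|a| ^+ 2 * 'Im b :> C.
  by rewrite ImMl // rpredX ?normr_real.
have q_neq0 : q != 0 by apply: contraTneq IH1 => ->; rewrite mul0r raddf0 ltxx.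
have z_neq0 : z != 0 by apply: contraTneq z_gt0 => ->; rewrite raddf0 ltxx.
have q_gt0 : 0 < `|q| ^+ 2 by rewrite exprn_gt0 ?normr_gt0.
have z2_gt0 : 0 < `|z| ^+ 2 by rewrite exprn_gt0 ?normr_gt0.
have Im1 : 'Im (1 : C) = 0 by apply/Creal_ImP; rewrite rpred1.
split.
  have -> : ((1 + z) * q + z * p) * q^* = `|q| ^+ 2 * (1 + z) + z * p * q^*.
    by rewrite normCK; ring.
  by rewrite raddfD /= realM raddfD /= Im1 add0r addr_gt0 // mulr_gt0.
have -> : z * q * ((1 + z) * q + z * p)^* =
    `|q| ^+ 2 * z + `|z| ^+ 2 * (`|q| ^+ 2 * 1) + `|z| ^+ 2 * (q * p^*).
  by rewrite !rmorphD !rmorphM rmorphD rmorph1 !normCK /=; ring.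
rewrite !raddfD /= !realM Im1 !mulr0 addr0.
by rewrite addr_gt0 // mulr_gt0.
Qed.

Lemma delannoy_Im_neq0 m z : 0 < 'Im z -> f m z != 0.
Proof.
move=> z_gt0; have [+ _] := delannoy_sector m z_gt0.
by apply: contraTneq => ->; rewrite rmorph0 mulr0 raddf0 ltxx.
Qed.

Lemma delannoy_real_zeros m z :
  root (map_poly intr (delannoy_poly m)) z -> z \is Num.real.
Proof.
move/rootP => fz0; apply/Creal_ImP/eqP.
case: (real_ltgt0P (Creal_Im z)) => // [z_gt0|z_lt0].
  by have := delannoy_Im_neq0 m z_gt0; rewrite fz0 eqxx.
have /(delannoy_Im_neq0 m) : 0 < 'Im z^* by rewrite Im_conj oppr_gt0.
suff -> : f m z^* = (f m z)^* by rewrite fz0 rmorph0 eqxx.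
rewrite -horner_map -map_poly_comp /=; congr (_.[_]).
by apply: eq_map_poly => k /=; rewrite rmorph_int.
Qed.

End RealZeros.

(** * The independence polynomial of the pendant ladder *)

Section Ladder.
Variable n : nat.
Local Notation V := (option (bool * 'I_n)).
Local Notation I := (indep_poly_in (pendant_ladder n)).

Definition rungs (k : nat) : {set V} :=
  [set v : V | if v is Some (b, i) then (i < k)%N else false].

Definition rungs_but_corner (c : bool) (k : nat) : {set V} :=
  [set v : V | if v is Some (b, i) then (i < k)%N && ~~ ((b == c) && (i.+1 == k))
           else false].

Let deleteE := indep_poly_in_delete (@pendant_ladder_sym n) (@pendant_ladder_irr n).

Lemma rungs_delete_corner c k : (k < n)%N ->
  I (rungs k.+1) = I (rungs_but_corner c k.+1) + 'X * I (rungs_but_corner c k).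
Proof.
move=> k_lt; pose v : V := Some (c, Ordinal k_lt).
rewrite (@deleteE _ v) ?inE //=.
congr (I _ + 'X * I _); apply/setP => -[[b i]|]; rewrite !inE //.
- by rewrite (inj_eq Some_inj) xpair_eqE -val_eqE /= eqSS andbC.
- rewrite (inj_eq Some_inj) xpair_eqE /= /ladder -!val_eqE /=.
  by case: b; case: c {v} => /=; lia.
Qed.

Lemma rungs_but_corner_delete c k : (k < n)%N ->
  I (rungs_but_corner c k.+1) = I (rungs k) + 'X * I (rungs_but_corner (~~ c) k).
Proof.
move=> k_lt; pose v : V := Some (~~ c, Ordinal k_lt).
rewrite (@deleteE _ v); last by rewrite inE /= ltnSn; case: c {v}.
congr (I _ + 'X * I _); apply/setP => -[[b i]|]; rewrite !inE //.
- by rewrite (inj_eq Some_inj) xpair_eqE -val_eqE /=; case: b; case: c {v} => /=; lia.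
- rewrite (inj_eq Some_inj) xpair_eqE /= /ladder -!val_eqE /=.
  by case: b; case: c {v} => /=; lia.
Qed.

Lemma pendant_delete : I setT = I (rungs n) + 'X * I (rungs_but_corner false n).
Proof.
rewrite (@deleteE _ None) ?inE //.
by congr (I _ + 'X * I _); apply/setP => -[[b i]|]; rewrite !inE //= ltn_ord.
Qed.

(** Both corners go through one induction because, by
    [rungs_but_corner_delete], the polynomial for one corner depends on that
    for the other.  The first equation stands for
    [I (rungs k) = f_k + x f_(k-1)], in a form that makes sense at [k = 0]. *)
Lemma indep_poly_in_rungs k : (k <= n)%N ->
  I (rungs k) + 'X * delannoy_poly k = delannoy_poly k.+1 /\
  forall c, I (rungs_but_corner c k) = delannoy_poly k.
Proof.
elim: k => [_|k IH k_lt].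
  have -> : rungs 0 = set0 by apply/setP => -[[b i]|]; rewrite !inE.
  rewrite indep_poly_in_set0 mulr1; split=> // c.
  rewrite /= -(indep_poly_in_set0 (pendant_ladder n)); congr I.
  by apply/setP => -[[b i]|]; rewrite !inE.
have [IHa IHb] := IH (ltnW k_lt).
have corner c : I (rungs_but_corner c k.+1) = delannoy_poly k.+1.
  by rewrite rungs_but_corner_delete // IHb IHa.
split=> //; rewrite (rungs_delete_corner false) // corner IHb delannoy_polySS.
by ring.
Qed.

Lemma indep_poly_pendant_ladder :
  indep_poly (pendant_ladder n) = delannoy_poly n.+1.
Proof.
have [rungsE cornerE] := indep_poly_in_rungs (leqnn n).
by rewrite -indep_poly_in_setT pendant_delete cornerE.
Qed.

End Ladder.

Theorem theorem5p1 (R : realType) (n : nat) :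
  symmetric_poly (indep_poly (pendant_ladder n)) /\
  only_real_zeros R (indep_poly (pendant_ladder n)).
Proof.
split; last first.
  by rewrite indep_poly_pendant_ladder => z; apply: delannoy_real_zeros.
split=> [k|].
  by rewrite coef_poly; case: ifP.
rewrite indep_poly_pendant_ladder size_delannoy /= => k k_le.
by have := coef_delannoy_sym k (n.+1 - k); rewrite subnKC //; lia.
Qed.
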